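(* Let $n\ge1$ and let $c=\{c_{ij}\}$ be a set of real numbers indexed by the diagonals of an $(n+3)$-gon. The polytope $$\mathcal{F}_c^\emptyset=\{x\in\mathcal{A}_{A_n}(\mathbb{R}^t) : A_{ij}^t(x)\le c_{ij}\text{ for all diagonals }\{ij\}\}$$ is a Stasheff polytope if and only if every vertex $\mathcal{F}_c^T$ ($T$ a complete triangulation) is contained in $\mathcal{F}_c^\emptyset$.
   Context: Fix an $(n+3)$-gon with vertices labeled $1,\dots,n+3$ clockwise. A segment $\{ij\}$ joins two distinct vertices; it is an edge if they are adjacent and a diagonal otherwise. A partial triangulation is a (possibly empty) set of pairwise non-crossing diagonals; it is complete if maximal. ''$i,j,k,l$ seated clockwise'' means four distinct vertices occurring in this cyclic clockwise order. A point $x\in\mathcal{A}_{A_n}(\mathbb{R}^t)$ (a real tropical point of the cluster $\mathcal{A}$-variety of type $A_n$) is a collection of real numbers $A_{ij}^t(x)$, one for each segment, with $A_{ij}^t(x)=0$ for edges and $A_{ik}^t(x)+A_{jl}^t(x)=\max\{A_{ij}^t(x)+A_{kl}^t(x),A_{il}^t(x)+A_{jk}^t(x)\}$ whenever $i,j,k,l$ are seated clockwise; for each complete triangulation $T$ the values on $T$ give a bijection $\mathcal{A}_{A_n}(\mathbb{R}^t)\simeq\mathbb{R}^n$. For a partial triangulation $T$, let $S(T)$ be the set of diagonals not in $T$ crossing no element of $T$, and define the $T$-face $\mathcal{F}_c^T=\{x\in\mathcal{A}_{A_n}(\mathbb{R}^t) : A_{ij}^t(x)=c_{ij}\ \forall\{ij\}\in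 T,\ A_{ij}^t(x)\le c_{ij}\ \forall\{ij\}\in S(T)\}$; $\mathcal{F}_c^\emptyset$ is by definition given by the inequalities for all diagonals. If $T$ is complete, $\mathcal{F}_c^T$ is a single point and is called a vertex. $\mathcal{F}_c^\emptyset$ is called a Stasheff polytope if $T_1\subseteq T_2$ implies $\mathcal{F}_c^{T_2}\subseteq\mathcal{F}_c^{T_1}$ for all partial triangulations $T_1,T_2$. *)

(* Defs.v *)
From mathcomp Require Import all_boot all_order all_algebra.
From mathcomp Require Import all_classical reals.

Set Implicit Arguments.
Unset Strict Implicit.
Unset Printing Implicit Defensive.

Import Order.TTheory GRing.Theory Num.Theory.

Local Open Scope classical_set_scope.
Local Open Scope ring_scope.

(* The vertices 1, ..., n+3 of the polygon, in clockwise order, are encoded as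
   the ordinals 0, ..., n+2; ordS is the clockwise successor modulo n+3. *)

Definition polygon_segment (n : nat) := {s : {set 'I_n.+3} | #|s| == 2%N}.

Definition is_edge (n : nat) (s : polygon_segment n) : bool :=
  [exists i : 'I_n.+3, val s == [set i; ordS i]%SET].

Definition polygon_diagonal (n : nat) := {s : polygon_segment n | ~~ is_edge s}.

Definition seated_clockwise (n : nat) (i j k l : 'I_n.+3) : bool :=
  [|| (i < j < k)%N && (k < l)%N,
      (j < k < l)%N && (l < i)%N,
      (k < l < i)%N && (i < j)%N
    | (l < i < j)%N && (j < k)%N].

(* Diagonals sharing an endpoint do not cross. *)
Definition crosses (n : nat) (d e : polygon_diagonal n) : bool :=
  [exists i : 'I_n.+3, exists j : 'I_n.+3,
   exists k : 'I_n.+3, exists l : 'I_n.+3,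
     [&& seated_clockwise i j k l,
         val (val d) == [set i; k]%SET & val (val e) == [set j; l]%SET]].

Definition partial_triangulation (n : nat) (T : {set polygon_diagonal n}) :
    bool :=
  [forall d in T, forall e in T, ~~ crosses d e].

Definition complete_triangulation (n : nat) (T : {set polygon_diagonal n}) :
    bool :=
  maxset (@partial_triangulation n) T.

(* The value of x on the segment {ij}; the default 0 is returned only if
   i = j, in which case [set i; j] is not a segment. *)
Definition coord (R : realType) (n : nat) (x : polygon_segment n -> R)
    (i j : 'I_n.+3) : R :=
  oapp x 0 (insub [set i; j]%SET).

Definition tropical_points (R : realType) (n : nat) :
    set (polygon_segment n -> R) :=
  [set x | (forall s : polygon_segment n, is_edge s -> x s = 0) /\
           (forall i j k l : 'I_n.+3, seated_clockwise i j k l ->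
              coord x i k + coord x j l =
              Num.max (coord x i j + coord x k l)
                      (coord x i l + coord x j k))].

Definition compatible_diagonals (n : nat) (T : {set polygon_diagonal n}) :
    {set polygon_diagonal n} :=
  [set d | (d \notin T) && [forall e in T, ~~ crosses d e]]%SET.

Definition face (R : realType) (n : nat) (c : polygon_diagonal n -> R)
    (T : {set polygon_diagonal n}) : set (polygon_segment n -> R) :=
  [set x | [/\ tropical_points x,
               forall d, d \in T -> x (val d) = c d
             & forall d, d \in compatible_diagonals T -> x (val d) <= c d]].

Definition stasheff_polytope (R : realType) (n : nat)
    (c : polygon_diagonal n -> R) : Prop :=
  forall T1 T2 : {set polygon_diagonal n},
    partial_triangulation T1 -> partial_triangulation T2 ->
    T1 \subset T2 -> face c T2 `<=` face c T1.

Lemma coordE (R : realType) (n : nat) (x : polygon_segment n -> R)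
    (s : polygon_segment n) (i j : 'I_n.+3) : val s = [set i; j]%SET -> coord x i j = x s.
Proof. by rewrite /coord => <-; rewrite valK. Qed.

Lemma crossesC (n : nat) (d e : polygon_diagonal n) : crosses d e = crosses e d.
Proof.
have sub (a b : polygon_diagonal n) : crosses a b -> crosses b a.
  case/existsP=> i /existsP[j] /existsP[k] /existsP[l] /and3P[h ha hb].
  apply/existsP; exists j; apply/existsP; exists k.
  apply/existsP; exists l; apply/existsP; exists i.
  rewrite hb (eqP ha) finset.setUC eqxx !andbT.
  by case/or4P: h => h; rewrite /seated_clockwise h ?orbT.
by apply/idP/idP; apply: sub.
Qed.

(* The empty face is cut out by the inequalities for all diagonals. *)
Lemma face_set0 (R : realType) (n : nat) (c : polygon_diagonal n -> R) :
  face c finset.set0 =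
  [set x | tropical_points x /\ forall d, x (val d) <= c d].
Proof.
apply/seteqP; split=> x /=.
  case=> hx _ h; split=> // d; apply: h.
  rewrite inE finset.in_set0 /=; apply/forallP=> e.
  by rewrite finset.in_set0.
case=> hx h; split=> // d; first by rewrite finset.in_set0.
by move=> _; apply: h.
Qed.

(* Main.v *)
From mathcomp Require Import all_boot all_order all_algebra.
From mathcomp Require Import all_classical reals.
From mathcomp Require Import zify lra.
Require Import Defs.

(** Write c for the given bounds, extended by 0 on edges.  Both conditions are
equivalent to the quadrilateral inequalities

      max (c_ij + c_kl) (c_il + c_jk) <= c_ik + c_jl

for all i, j, k, l seated clockwise, and these are what the nontrivial
direction goes through; the other direction compares T with its empty subset.

From vertices to inequalities ([vertices_quadrilateral]).  It suffices to find
a complete triangulation containing ij, ik and kl (where these are diagonals)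
together with a tropical point x taking the values c on it: this vertex
satisfies c_jl >= x_jl >= x_ij + x_kl - x_ik = c_ij + c_kl - c_ik, and the other
half of the inequality is the same one for j, k, l, i.  The triangulation
[zigzag i k l] joins i to every vertex off the open arc from k to l, and k to
every vertex of the half-open arc up to l.  Its vertex is explicit.  For the fan
of all diagonals at i, the tropical point with prescribed values a_p on ip is

      x_pq = a_p + a_q + max_(p <= r < q) (- a_r - a_(r+1)),

the tropical form of the additivity of the ratios x_pq / (x_ip x_iq)
([fan_value_ptolemy]).  The values a_p on the arc from k to l can be solved for
recursively so that the segments from k to that arc receive the prescribed
values ([fan_value_prescribed]), whence [zigzag_point].

From inequalities to faces ([face_bounded]).  A point x of the T-face satisfies
x_d <= c_d for every diagonal d, by induction on the number of elements of T
that d crosses.  If d = ik crosses e = jl in T, then every element of T crossing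
a side of the quadrilateral ijkl also crosses d, since it does not cross e
([joins_crossing_side]); as e crosses d but no side, the induction hypothesis
bounds x on the four sides, and the exchange relation gives
x_ik <= max (c_ij + c_kl) (c_il + c_jk) - c_jl <= c_ik.  Hence every face lies
in all half-spaces x_d <= c_d, which is more than containment of faces asks. *)

Set Implicit Arguments.
Unset Strict Implicit.
Unset Printing Implicit Defensive.

Import Order.TTheory GRing.Theory Num.Theory.

Local Open Scope classical_set_scope.
Local Open Scope ring_scope.

(* Innermost maxima are split first, so that no hypothesis retains a maximum. *)
Ltac max_lra :=
  repeat match goal with
  | |- context [Num.max ?x ?y] =>
      lazymatch constr:((x, y)) with
      | context [Num.max _ _] => fail
      | _ => case: (leP x y) => ?
      end
  end; intros; lra.

(** * Tropical points from fan coordinates *)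

Section Fan.
Variable R : realType.
Implicit Types (f a : nat -> R) (p q r s : nat).

Fixpoint running_max f p d : R :=
  if d is e.+1 then Num.max (running_max f p e) (f (p + d)%N) else f p.

Lemma running_max_cat f p d e :
  running_max f p (d + e).+1 =
  Num.max (running_max f p d) (running_max f (p + d).+1 e).
Proof.
elim: e => [|e IH]; first by rewrite addn0 /= addnS.
by rewrite addnS [LHS]/= -/(running_max f p (d + e).+1) IH -maxA /= !addnS addSn addnA.
Qed.

(** The value on the segment joining vertices p < q of the tropical point whose
value on the segment from the apex 0 to r is [a r], with value 0 on the edges
away from the apex.  The maximum runs over p <= r < q, which are [(q - p).-1.+1] indices. *)
Definition fan_value a p q : R :=
  if p == 0%N then a q
  else a p + a q + running_max (fun r => - a r - a r.+1) p (q - p).-1.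

Lemma fan_value_edge a p : (0 < p)%N -> fan_value a p p.+1 = 0.
Proof.
case: p => // p _; rewrite /fan_value /= subSnn /=; lra.
Qed.

Lemma running_max_split f p q r : (p < q)%N -> (q < r)%N ->
  running_max f p (r - p).-1 =
  Num.max (running_max f p (q - p).-1) (running_max f q (r - q).-1).
Proof.
move=> pq qr.
have -> : (r - p).-1 = ((q - p).-1 + (r - q).-1).+1 by lia.
rewrite running_max_cat; congr (Num.max _ (running_max _ _ _)); lia.
Qed.

(** Away from the apex, the linear terms cancel and the claim is the identity
max P Q + max Q S = max (P + S) (max P Q S + Q) for the maxima P, Q, S over
three consecutive ranges. *)
Lemma fan_value_ptolemy a p q r s : (p < q)%N -> (q < r)%N -> (r < s)%N ->
  fan_value a p r + fan_value a q s =
  Num.max (fan_value a p q + fan_value a r s)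
          (fan_value a p s + fan_value a q r).
Proof.
move=> pq qr rs; rewrite /fan_value.
have [-> ->] : (q == 0)%N = false /\ (r == 0)%N = false by split; lia.
case: eqP => [_|_].
  by rewrite (running_max_split _ qr rs); max_lra.
rewrite (running_max_split _ pq (ltn_trans qr rs)) (running_max_split _ qr rs).
rewrite (running_max_split _ pq qr).
max_lra.
Qed.

(** Fan coordinates strictly between k and l can be chosen to give prescribed
values b on the segments from k to the range k < q <= l.  The exchange relation
for 0, k, q, q+1, with value 0 on the edge from q to q+1, reads
a_q + b_(q+1) = max (b_q + a_(q+1)) a_k, so a_q is determined by a_(q+1), starting
from a_l. *)
Lemma fan_value_prescribed (k l : nat) (a b : nat -> R) :
  (0 < k)%N -> (k < l)%N -> b k.+1 = 0 ->
  exists a' : nat -> R,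
    (forall q, (q <= k)%N || (l <= q)%N -> a' q = a q) /\
    (forall q, (k < q <= l)%N -> fan_value a' k q = b q).
Proof.
move=> k0 kl bk.
(* [h d] is the difference a_q - b_q for q = l - d, in which the recursion is
   a maximum with a known quantity. *)
pose h := fix h d : R := if d is e.+1
  then Num.max (h e) (a k - b (l - d)%N - b (l - e)%N) else a l - b l.
exists (fun q => if (q <= k)%N || (l <= q)%N then a q
                 else b q + h (l - q)%N); split=> [q -> //|].
set a' := fun q => _.
have a'h q : (k < q <= l)%N -> a' q = b q + h (l - q)%N.
  move=> /andP[kq ql]; rewrite /a'; case: ifP => // C.
  have -> : q = l by lia.
  by rewrite subnn /=; lra.
have a'k : a' k = a k by rewrite /a' leqnn.
have k0' : (k == 0)%N = false by apply/eqP; lia.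
elim=> [//|q IH] /andP[]; rewrite ltnS leq_eqVlt => /orP[/eqP <- _|kq ql].
  by rewrite fan_value_edge.
have := IH; rewrite kq (ltnW ql) => /(_ isT).
rewrite /fan_value k0' (running_max_split _ kq (ltnSn q)) subSnn /=.
rewrite a'k (a'h q) ?kq ?(ltnW ql) // (a'h q.+1) ?ql ?(ltnW kq) //;
  last by rewrite ltnW.
have -> : (l - q = (l - q.+1).+1)%N by lia.
rewrite /=.
have -> : (l - (l - q.+1).+1 = q)%N by lia.
have -> : (l - (l - q.+1) = q.+1)%N by lia.
set M := running_max _ _ _.
set H := h _.
max_lra.
Qed.

End Fan.

(** * Segments and crossings of the polygon *)

Section Geometry.
Variable n : nat.
Implicit Types (i j k l p q r s : 'I_n.+3) (d e : polygon_diagonal n).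

Definition joins_crossing p q r s : bool :=
  seated_clockwise p r q s || seated_clockwise p s q r.

Lemma set2_eq (T : finType) (a b p q : T) :
  [set a; b]%SET = [set p; q]%SET -> (a = p /\ b = q) \/ (a = q /\ b = p).
Proof.
move=> E.
have ha : a \in [set p; q]%SET by rewrite -E set21.
have hb : b \in [set p; q]%SET by rewrite -E set22.
have hp : p \in [set a; b]%SET by rewrite E set21.
have hq : q \in [set a; b]%SET by rewrite E set22.
move: ha hb hp hq; rewrite !finset.in_set2.
do 4 (case/orP=> /eqP ?); subst; by [left|right].
Qed.

Lemma segment_ends (s : polygon_segment n) :
  exists p q, p != q /\ val s = [set p; q]%SET.
Proof.
by apply/cards2P; exact: valP s.
Qed.

Lemma segment_of p q : p != q ->
  exists s : polygon_segment n, val s = [set p; q]%SET.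
Proof.
move=> pq; have h : #|[set p; q]%SET| == 2%N by rewrite cards2 pq.
by exists (Sub [set p; q]%SET h : polygon_segment n); rewrite SubK.
Qed.

Definition adjacent p q : bool :=
  [|| p.+1 == q :> nat, q.+1 == p :> nat,
      (p == 0 :> nat) && (q == n.+2 :> nat) | (q == 0 :> nat) && (p == n.+2 :> nat)]%N.

Lemma adjacentC p q : adjacent p q = adjacent q p.
Proof. by apply/idP/idP; rewrite /adjacent; lia. Qed.

Lemma val_ordS p : ordS p = (if p == n.+2 :> nat then 0 else p.+1)%N :> nat.
Proof.
rewrite /=; case: eqP => [->|C]; first by rewrite modnn.
by rewrite modn_small //; have := ltn_ord p; lia.
Qed.

Lemma adjacentP p q : adjacent p q = (q == ordS p) || (p == ordS q).
Proof.
rewrite -!val_eqE /adjacent /= -/(nat_of_ord (ordS p)).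
have := val_ordS p; have := val_ordS q => /= -> ->.
have := ltn_ord p; have := ltn_ord q.
by do 2 case: ifP; lia.
Qed.

Lemma is_edgeE (s : polygon_segment n) p q :
  val s = [set p; q]%SET -> is_edge s = adjacent p q.
Proof.
move=> E; rewrite adjacentP; apply/existsP/idP.
  case=> i; rewrite E => /eqP /set2_eq [[-> ->]|[-> ->]]; by rewrite eqxx ?orbT.
case/orP=> /eqP h; [exists p|exists q]; by rewrite E h // finset.setUC.
Qed.

Lemma diagonal_of p q : p != q -> ~~ adjacent p q ->
  exists d, val (val d) = [set p; q]%SET.
Proof.
move=> /segment_of[s E] nadj.
have h : ~~ is_edge s by rewrite (is_edgeE E).
by exists (Sub s h : polygon_diagonal n); rewrite SubK.
Qed.

Lemma diagonal_ends d :
  exists p q, [/\ p != q, ~~ adjacent p q & val (val d) = [set p; q]%SET].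
Proof.
have [p [q [pq E]]] := segment_ends (val d).
by exists p, q; split=> //; rewrite -(is_edgeE E); exact: valP d.
Qed.

Lemma crossesE d e p q r s :
  val (val d) = [set p; q]%SET -> val (val e) = [set r; s]%SET ->
  crosses d e = joins_crossing p q r s.
Proof.
move=> hd he; apply/idP/idP.
  case/existsP=> i /existsP[j] /existsP[k] /existsP[l] /and3P[h].
  rewrite hd he => /eqP/set2_eq hd' /eqP/set2_eq he'.
  move: h; rewrite /joins_crossing /seated_clockwise.
  by case: hd' => -[-> ->]; case: he' => -[-> ->]; lia.
case/orP=> h; apply/existsP; exists p; apply/existsP.
  exists r; apply/existsP; exists q; apply/existsP; exists s.
  by rewrite h hd he !eqxx.
exists s; apply/existsP; exists q; apply/existsP; exists r.
by rewrite h hd he (finset.setUC [set r]%SET) !eqxx.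
Qed.

(** Clockwise distance from i to p, which turns the cyclic order of the vertices
into the linear order of the integers starting at i. *)
Definition offset i p : nat := if (i <= p)%N then (p - i)%N else (p + n.+3 - i)%N.

Lemma offset_lt i p : (offset i p < n.+3)%N.
Proof. rewrite /offset; have := ltn_ord p; have := ltn_ord i; case: ifP; lia. Qed.

Lemma offset_inj i : injective (offset i).
Proof.
move=> p q; rewrite /offset => h; apply: val_inj => /=; move: h.
have := ltn_ord p; have := ltn_ord q; have := ltn_ord i.
by do 2 case: ifP; lia.
Qed.

Definition at_offset i (b : nat) : 'I_n.+3 :=
  inord (if (i + b < n.+3)%N then (i + b)%N else (i + b - n.+3)%N).

Lemma at_offsetK i b : (b < n.+3)%N -> offset i (at_offset i b) = b.
Proof.
move=> hb; have hi := ltn_ord i.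
rewrite /offset /at_offset; case: (ltnP (i + b) n.+3) => h.
  by rewrite inordK //; case: ifP; lia.
by rewrite inordK; [case: ifP; lia | lia].
Qed.

Lemma offsetK i : cancel (offset i) (at_offset i).
Proof. by move=> p; apply: (@offset_inj i); rewrite at_offsetK ?offset_lt. Qed.

Lemma offset0 i : offset i i = 0%N.
Proof. by rewrite /offset leqnn subnn. Qed.

Lemma offset_eq i p q : (p == q) = (offset i p == offset i q).
Proof. by rewrite (inj_eq (@offset_inj i)). Qed.

Definition nat_clockwise (a b c d : nat) : bool :=
  [|| (a < b < c) && (c < d), (b < c < d) && (d < a),
      (c < d < a) && (a < b) | (d < a < b) && (b < c)]%N.

Lemma offset_ltn x p q : (offset x p < offset x q)%N =
  if (x <= p)%N == (x <= q)%N then (p < q)%N else (x <= p)%N.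
Proof.
have := ltn_ord p; have := ltn_ord q; have := ltn_ord x; rewrite /offset.
by case: (leqP x p) => ?; case: (leqP x q) => ? /=; lia.
Qed.

Lemma seated_offset x i j k l : seated_clockwise i j k l =
  nat_clockwise (offset x i) (offset x j) (offset x k) (offset x l).
Proof.
rewrite /seated_clockwise /nat_clockwise !offset_ltn.
by case: (leqP x i) => ?; case: (leqP x j) => ?; case: (leqP x k) => ?;
  case: (leqP x l) => ? /=; lia.
Qed.

Lemma joins_crossing_offset (x p q r s : 'I_n.+3) :
  (offset x p < offset x q)%N ->
  joins_crossing p q r s =
  let inside t := (offset x p < offset x t < offset x q)%N in
  let outside t := ((offset x t < offset x p) || (offset x q < offset x t))%N in
  inside r && outside s || inside s && outside r.
Proof.
rewrite /joins_crossing !(seated_offset x) /nat_clockwise /=.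
move: (offset x p) (offset x q) (offset x r) (offset x s) => a b c d ab.
by case: (ltngtP a c) => ?; case: (ltngtP c b) => ?; case: (ltngtP a d) => ?;
  case: (ltngtP d b) => ? //=; lia.
Qed.

(** Let f join r and s.  If f crosses a side of the quadrilateral ijkl, then one
end of f lies on the arc cut off by that side; since f does not cross jl, the
other end lies on the opposite side of ik. *)
Lemma joins_crossing_side (i j k l p q r s : 'I_n.+3) :
  seated_clockwise i j k l ->
  [\/ p = i /\ q = j, p = j /\ q = k, p = k /\ q = l | p = i /\ q = l] ->
  ~~ joins_crossing j l r s -> joins_crossing p q r s -> joins_crossing i k r s.
Proof.
rewrite (seated_offset i) /nat_clockwise offset0 => h hpq.
have [j0 jk kl] : [/\ 0 < offset i j, offset i j < offset i k
                    & offset i k < offset i l]%N by split; lia.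
case: hpq => -[-> ->]; rewrite !(joins_crossing_offset (x := i)) ?offset0 //=; lia.
Qed.

Lemma adjacent_offset x p q : adjacent p q =
  let a := offset x p in let b := offset x q in
  [|| a.+1 == b, b.+1 == a, (a == 0) && (b == n.+2) | (b == 0) && (a == n.+2)]%N.
Proof.
have := ltn_ord p; have := ltn_ord q; have := ltn_ord x.
rewrite /adjacent /offset /=.
by do 2 case: ifP; lia.
Qed.

(** * Zigzag triangulations *)

Lemma diagonal_offset_ends i d :
  exists p q, [/\ (offset i p < offset i q)%N, ~~ adjacent p q &
                  val (val d) = [set p; q]%SET].
Proof.
have [p [q [pq nadj E]]] := diagonal_ends d.
move: pq; rewrite (offset_eq i) neq_ltn => /orP[h|h]; first by exists p, q.
by exists q, p; rewrite adjacentC finset.setUC.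
Qed.

(** In offsets from i, with u and v those of k and l: the pairs a < b joined by an
element of [zigzag i k l], possibly an edge. *)
Definition zigzag_pair (u v a b : nat) : bool :=
  ((a == 0) && ~~ (u < b < v) || (a == u) && (u < b <= v))%N.

Definition zigzag i k l : {set polygon_diagonal n} :=
  [set d | [exists p, exists q,
     [&& val (val d) == [set p; q]%SET, (offset i p < offset i q)%N &
         zigzag_pair (offset i k) (offset i l) (offset i p) (offset i q)]]]%SET.

Lemma in_zigzag i k l d p q :
  val (val d) = [set p; q]%SET -> (offset i p < offset i q)%N ->
  (d \in zigzag i k l) =
  zigzag_pair (offset i k) (offset i l) (offset i p) (offset i q).
Proof.
move=> E pq; rewrite inE; apply/existsP/idP.
  case=> p' /existsP[q' /and3P[]]; rewrite E => /eqP/set2_eq[[<- <-]|[<- <-]] //.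
  by rewrite ltnNge ltnW.
by move=> h; exists p; apply/existsP; exists q; rewrite E eqxx pq.
Qed.

Lemma zigzag_noncrossing i k l :
  (0 < offset i k)%N -> partial_triangulation (zigzag i k l).
Proof.
move=> k0; apply/forallP=> d; apply/implyP=> hd.
apply/forallP=> e; apply/implyP=> he.
have [p [q [pq _ Ed]]] := diagonal_offset_ends i d.
have [r [s [rs _ Ee]]] := diagonal_offset_ends i e.
move: hd he; rewrite (in_zigzag _ _ Ed pq) (in_zigzag _ _ Ee rs).
rewrite (crossesE Ed Ee) /joins_crossing !(seated_offset i).
move: pq rs k0; rewrite /zigzag_pair /nat_clockwise; lia.
Qed.

(** Let d join the offsets a < b.  If a = 0, then d ends inside the arc from k to l
and crosses kl.  Otherwise d separates i from any vertex between a and b: it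
crosses a segment from i if one of these is off the arc, and a segment from k
if they all are on it. *)
Lemma zigzag_blocks i k l d :
  (0 < offset i k)%N -> (offset i k < offset i l)%N -> d \notin zigzag i k l ->
  exists2 e, e \in zigzag i k l & crosses d e.
Proof.
move=> k0 kl; have [p [q [pq nadj Ed]]] := diagonal_offset_ends i d.
rewrite (in_zigzag _ _ Ed pq) => nzz.
have ql := offset_lt i q; have ll := offset_lt i l.
suff [a [b [ab bn bad zz X]]] : exists a b, [/\ (a < b)%N, (b < n.+3)%N,
    ((b != a.+1) && ~~ ((a == 0) && (b == n.+2)))%N,
    zigzag_pair (offset i k) (offset i l) a b &
    nat_clockwise (offset i p) a (offset i q) b ||
    nat_clockwise (offset i p) b (offset i q) a].
  have an : (a < n.+3)%N by lia.
  have [| |e Ee] := @diagonal_of (at_offset i a) (at_offset i b).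
  - by rewrite (offset_eq i) !at_offsetK //; lia.
  - by rewrite (adjacent_offset i) /= !at_offsetK //; lia.
  exists e; first by rewrite (in_zigzag _ _ Ee) !at_offsetK.
  by rewrite (crossesE Ed Ee) /joins_crossing !(seated_offset i) !at_offsetK.
move: nadj; rewrite (adjacent_offset i) /=.
move: nzz pq ql ll k0 kl; rewrite /zigzag_pair /nat_clockwise.
move: (offset i p) (offset i q) (offset i k) (offset i l) => a b u v.
move=> nzz pq ql ll k0 kl nadj.
have [a0|a0] := eqVneq a 0%N.
  by exists u, v; split; lia.
have [hu|hu] := leqP u a; have [hv|hv] := leqP b v.
- by exists u, a.+1; split; lia.
- by exists 0%N, b.-1; split; lia.
- by exists 0%N, a.+1; split; lia.
- by exists 0%N, a.+1; split; lia.
Qed.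

Lemma zigzag_complete i k l :
  (0 < offset i k)%N -> (offset i k < offset i l)%N ->
  complete_triangulation (zigzag i k l).
Proof.
move=> k0 kl; apply/maxsetP; split; first exact: zigzag_noncrossing.
move=> B /forallP hB sB; apply/eqP; rewrite finset.eqEsubset sB andbT.
apply/fintype.subsetP=> d dB; apply: contraT => /(zigzag_blocks k0 kl)[e ez X].
have := hB d; rewrite dB /= => /forallP/(_ e).
by rewrite (fintype.subsetP sB _ ez) X.
Qed.

End Geometry.

(** * Vertices of zigzag triangulations *)

Section TropicalPoints.
Variables (R : realType) (n : nat).
Implicit Types (i j k l p q : 'I_n.+3) (d e : polygon_diagonal n).
Implicit Types (x : polygon_segment n -> R) (c : polygon_diagonal n -> R).

Lemma coordC x p q : coord x p q = coord x q p.
Proof. by rewrite /coord finset.setUC. Qed.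

Lemma realize_pairing i (g : nat -> nat -> R) : exists x, forall p q,
  (offset i p < offset i q)%N -> coord x p q = g (offset i p) (offset i q).
Proof.
exists (fun s => if [pick u : 'I_n.+3 * 'I_n.+3 |
    (offset i u.1 < offset i u.2)%N && (val s == [set u.1; u.2]%SET)] is Some u
  then g (offset i u.1) (offset i u.2) else 0) => p q pq.
have npq : p != q by rewrite (offset_eq i) ltn_eqF.
have [s E] := segment_of npq; rewrite (coordE _ E).
case: pickP => [[p' q'] /= /andP[p'q']|/(_ (p, q))]; rewrite E.
  by move/eqP/set2_eq=> [[-> ->]//|[Ep Eq]]; rewrite Ep Eq ltnNge ltnW in pq.
by rewrite /= pq eqxx.
Qed.

Definition exchange_relation x i j k l : Prop :=
  coord x i k + coord x j l =
  Num.max (coord x i j + coord x k l) (coord x i l + coord x j k).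

Lemma exchange_relation_rot x i j k l :
  exchange_relation x j k l i -> exchange_relation x i j k l.
Proof.
rewrite /exchange_relation maxC (coordC x k i) (coordC x j i) (coordC x l i).
by rewrite addrC => ->; rewrite [coord x j k + _]addrC.
Qed.

(** The exchange relation is invariant under rotation of the four vertices, so it
may be checked in the linear order starting at any vertex. *)
Lemma exchange_relation_offset x i :
  (forall p q r s, (offset i p < offset i q)%N -> (offset i q < offset i r)%N ->
     (offset i r < offset i s)%N -> exchange_relation x p q r s) ->
  forall p q r s, seated_clockwise p q r s -> exchange_relation x p q r s.
Proof.
move=> H p q r s; rewrite (seated_offset i).
case/or4P=> /andP[/andP[h1 h2] h3].
- exact: H.
- by apply: exchange_relation_rot; apply: H.
- by do 2 apply: exchange_relation_rot; apply: H.
- by do 3 apply: exchange_relation_rot; apply: H.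
Qed.

(** The vertex of a zigzag triangulation: the fan formula at i, whose coordinates
on the arc from k to l are chosen to match the values on the segments from k. *)
Lemma zigzag_point (y : polygon_segment n -> R) i k l :
  (forall s, is_edge s -> y s = 0) ->
  (0 < offset i k)%N -> (offset i k < offset i l)%N ->
  exists x, [/\ tropical_points x,
    forall q, q != i -> ~~ (offset i k < offset i q < offset i l)%N ->
      coord x i q = coord y i q &
    forall q, (offset i k < offset i q <= offset i l)%N ->
      coord x k q = coord y k q].
Proof.
move=> y0 k0 kl.
pose a b := coord y i (at_offset i b).
pose b r := coord y k (at_offset i r).
have ll := offset_lt i l.
have bk : b (offset i k).+1 = 0.
  have k'n : ((offset i k).+1 < n.+3)%N by lia.
  have nk : k != at_offset i (offset i k).+1.
    by rewrite (offset_eq i) at_offsetK // ltn_eqF.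
  have [s E] := segment_of nk; rewrite /b (coordE y E) y0 //.
  by rewrite (is_edgeE E) (adjacent_offset i) /= at_offsetK // eqxx.
have [a' [a'a a'b]] := fan_value_prescribed a k0 kl bk.
have [x hx] := realize_pairing i (fan_value a').
have xi q : q != i -> ~~ (offset i k < offset i q < offset i l)%N ->
    coord x i q = coord y i q.
  rewrite (offset_eq i) offset0 => qi h.
  rewrite hx ?offset0 ?lt0n // /fan_value eqxx a'a; last by lia.
  by rewrite /a offsetK.
exists x; split=> //; last first.
  move=> q h; rewrite hx ?a'b //; last by case/andP: h.
  by rewrite /b offsetK.
split.
  move=> s hs.
  have [p [q [pq E]]] : exists p q, (offset i p < offset i q)%N /\
      val s = [set p; q]%SET.
    have [p [q [pq E]]] := segment_ends s.
    move: pq; rewrite (offset_eq i) neq_ltn => /orP[h|h]; first by exists p, q.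
    by exists q, p; rewrite finset.setUC.
  have := hs; rewrite (is_edgeE E) (adjacent_offset i) /= => hadj.
  have qn := offset_lt i q.
  have [p0|p0] := eqVneq (offset i p) 0%N.
    have pi : p = i by apply: (@offset_inj _ i); rewrite offset0.
    move: (E); rewrite pi => Ei; rewrite -(coordE x Ei) xi.
    - by rewrite (coordE y Ei) y0.
    - by rewrite (offset_eq i) offset0 -p0 gtn_eqF.
    - by lia.
  rewrite -(coordE x E) hx //.
  have -> : offset i q = (offset i p).+1 by lia.
  by rewrite fan_value_edge // lt0n.
apply: (@exchange_relation_offset x i) => p q r s pq qr rs.
rewrite /exchange_relation !hx //; try lia.
exact: fan_value_ptolemy.
Qed.

(** * The quadrilateral inequalities *)

(** The bounds completed by 0 on edges, so that the sides of a quadrilateral need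
no case distinction. *)
Definition extend c : polygon_segment n -> R := fun s => oapp c 0 (insub s).

Lemma extend_diagonal c d : extend c (val d) = c d.
Proof. by rewrite /extend valK. Qed.

Lemma extend_edge c s : is_edge s -> extend c s = 0.
Proof. by move=> h; rewrite /extend insubF // h. Qed.

Lemma seated_diagonal i j k l : seated_clockwise i j k l ->
  exists d, val (val d) = [set i; k]%SET.
Proof.
move=> h; apply: diagonal_of.
  by rewrite -val_eqE /=; move: h; rewrite /seated_clockwise; lia.
move: h; rewrite /seated_clockwise /adjacent.
have := ltn_ord i; have := ltn_ord j; have := ltn_ord k; have := ltn_ord l; lia.
Qed.

(** Compare jl with the vertex of [zigzag i k l], whose exchange relation for
i, j, k, l has x_ij, x_ik and x_kl equal to the bounds. *)
Lemma vertices_quadrilateral c :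
  (forall T, complete_triangulation T -> face c T `<=` face c finset.set0) ->
  forall i j k l, seated_clockwise i j k l ->
  coord (extend c) i j + coord (extend c) k l <=
  coord (extend c) i k + coord (extend c) j l.
Proof.
move=> hV i j k l hs.
have := hs; rewrite (seated_offset i) /nat_clockwise offset0 => hoff.
have [k0 kl jk j0] : [/\ 0 < offset i k, offset i k < offset i l,
  offset i j < offset i k & 0 < offset i j]%N by split; lia.
have [x [xtrop xi xk]] := zigzag_point (@extend_edge c) k0 kl.
have xT : face c (zigzag i k l) x.
  split=> // d.
    have [p [q [pq _ E]]] := diagonal_offset_ends i d.
    rewrite (in_zigzag _ _ E pq) -(extend_diagonal c) -!(coordE _ E).
    case/orP=> /andP[/eqP]; rewrite -?[0%N](offset0 i) => /offset_inj -> h.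
      by apply: xi => //; rewrite (offset_eq i) offset0 -lt0n; lia.
    exact: xk.
  rewrite inE => /andP[/(zigzag_blocks k0 kl)[e ez X] /forallP/(_ e)].
  by rewrite ez X.
have [_ _ xle] := hV _ (zigzag_complete k0 kl) _ xT.
have hs' : seated_clockwise j k l i by move: hs; rewrite /seated_clockwise; lia.
have [d Ed] := seated_diagonal hs'.
have d0 : d \in compatible_diagonals (finset.set0 : {set polygon_diagonal n}).
  by rewrite inE finset.in_set0; apply/forallP=> e; rewrite finset.in_set0.
have := xle d d0; rewrite -(extend_diagonal c) -!(coordE _ Ed).
case: xtrop => _ /(_ _ _ _ _ hs).
rewrite (xi j) ?(xi k) ?(xk l) ?(offset_eq i _ i) ?offset0; try lia.
by max_lra.
Qed.

(** Flipping d against an element of T that it crosses expresses x_d through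
segments crossing strictly fewer elements of T. *)
Lemma face_bounded c (T : {set polygon_diagonal n}) x :
  (forall i j k l, seated_clockwise i j k l ->
     coord (extend c) i j + coord (extend c) k l <=
     coord (extend c) i k + coord (extend c) j l) ->
  partial_triangulation T -> face c T x -> forall d, x (val d) <= c d.
Proof.
move=> hQ /forallP hT [[x0 xex] xT xS] d.
have [m] := ubnP #|[set e in T | crosses d e]%SET|.
elim: m d => // m IH d; rewrite ltnS => hm.
have [dT|dT] := boolP (d \in T); first by rewrite xT.
have [/forallP h|] := boolP [forall e in T, ~~ crosses d e].
  by apply: xS; rewrite inE dT; apply/forallP.
rewrite negb_forall => /existsP[e]; rewrite negb_imply negbK => /andP[eT de].
case/existsP: (de) => i /existsP[j] /existsP[k] /existsP[l].
case/and3P=> hs /eqP Ed /eqP Ee.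
have side p q :
    [\/ p = i /\ q = j, p = j /\ q = k, p = k /\ q = l | p = i /\ q = l] ->
    coord x p q <= coord (extend c) p q.
  move=> hpq.
  have npq : p != q.
    rewrite -val_eqE /=.
    by move: hs; rewrite /seated_clockwise; case: hpq => -[-> ->]; lia.
  have [s Es] := segment_of npq; rewrite !(coordE _ Es).
  have [hedge|hdiag] := boolP (is_edge s); first by rewrite x0 // extend_edge.
  pose d' : polygon_diagonal n := Sub s hdiag.
  have Ed' : val d' = s by rewrite SubK.
  rewrite -Ed' extend_diagonal; apply: IH.
  apply: leq_trans hm; apply: proper_card; apply/properP; split.
    apply/fintype.subsetP=> f; rewrite !inE => /andP[fT].
    have [r [t [_ _ Ef]]] := diagonal_ends f.
    have ef : ~~ crosses e f by have := hT e; rewrite eT => /forallP/(_ f); rewrite fT.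
    move: ef; rewrite fT (crossesE Ee Ef) (crossesE Ed Ef).
    rewrite (@crossesE _ d' f p q r t) ?Ed' //.
    exact: joins_crossing_side hs hpq.
  (* e shares an end with each side, hence does not cross it *)
  exists e; rewrite !inE eT ?de //= (@crossesE _ d' e p q j l) ?Ed' //.
  by move: hs; rewrite /joins_crossing /seated_clockwise; case: hpq => -[-> ->]; lia.
(* the two halves of the quadrilateral inequality *)
have hs' : seated_clockwise j k l i by move: hs; rewrite /seated_clockwise; lia.
have := xex _ _ _ _ hs; have := hQ _ _ _ _ hs; have := hQ _ _ _ _ hs'.
have := side i j (Or41 _ _ _ (conj erefl erefl)).
have := side j k (Or42 _ _ _ (conj erefl erefl)).
have := side k l (Or43 _ _ _ (conj erefl erefl)).
have := side i l (Or44 _ _ _ (conj erefl erefl)).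
rewrite (coordC _ l i) (coordC _ k i) !(coordE _ Ed) !(coordE _ Ee).
rewrite !extend_diagonal (xT e eT).
by max_lra.
Qed.

End TropicalPoints.

Theorem theorem2p4 (R : realType) (n : nat) (hn : (1 <= n)%N)
    (c : polygon_diagonal n -> R) :
  stasheff_polytope c <->
  (forall T : {set polygon_diagonal n},
     complete_triangulation T -> face c T `<=` face c finset.set0).
Proof.
split=> [hc T /maxsetp hT|hV T1 T2 _ hT2 T12 x xT2].
  apply: hc (finset.sub0set T) => //.
  by apply/forallP=> d; rewrite finset.in_set0.
have xle := face_bounded (vertices_quadrilateral hV) hT2 xT2.
have [xtrop xT _] := xT2.
by split=> // d hd; apply: xT; apply: (fintype.subsetP T12).
Qed.
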